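(* Let $n\ge2$, let $z\in B_n$ have $n$-greedy normal form $(m;s_1,\dots,s_p)$, and let $u$ be a simple $n$-braid. (i) Put $u_p:=u$ and, for $i=p,p-1,\dots,1$, let $u_{i-1},s'_i$ be the simple braids determined by $$s_i\,u_i=u_{i-1}\,s'_i\quad\text{and}\quad(u_{i-1},s'_i)\ \text{is normal}.$$ Then the greedy normal form of $zu$ is $(m+1;s'_1,\dots,s'_p)$ if $u_0=\Delta_n$ holds, and $(m;u_0,s'_1,\dots,s'_p)$ otherwise, in each case up to deleting the trailing entries equal to $1$. (ii) Put $u_p:=u$ and, for $i=p,p-1,\dots,1$, let $u_{i-1},s'_i$ be the simple braids determined by $$s'_i\,u_i=u_{i-1}\,s_i\quad\text{and}\quad\gcd\nolimits_L(s'_i,u_{i-1})=1 .$$ Then the greedy normal form of $zu^{-1}$ is $(m;s'_1,\dots,s'_p)$ if $u_0=1$ holds, and $(m-1;{}^*u_0,s'_1,\dots,s'_p)$ otherwise, in each case up to deleting the trailing entries equal to $1$.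
   Context: $B_n$ is Artin's braid group with generators $\sigma_1,\dots,\sigma_{n-1}$ and relations $\sigma_i\sigma_j=\sigma_j\sigma_i$ for $|i-j|\ge2$, $\sigma_i\sigma_j\sigma_i=\sigma_j\sigma_i\sigma_j$ for $|i-j|=1$; $B_n^+$ is the submonoid generated by $\sigma_1,\dots,\sigma_{n-1}$ (positive braids). For $x,y\in B_n^+$, $x$ is a left (resp. right) divisor of $y$ if $y=xz$ (resp. $y=zx$) for some $z\in B_n^+$. Any two $x,y\in B_n^+$ have a greatest common left divisor $\gcd_L(x,y)$ and a least common left multiple $\mathrm{lcm}_L(x,y)$. $\Delta_n\in B_n^+$ is defined by $\Delta_1=1$, $\Delta_n=\sigma_1\sigma_2\cdots\sigma_{n-1}\Delta_{n-1}$. Simple braids are the left divisors of $\Delta_n$ in $B_n^+$ (which coincide with its right divisors). For $s$ simple, ${}^*s$ is the unique (simple) braid with ${}^*s\,s=\Delta_n$. A sequence $(s_1,\dots,s_p)$ of simple braids is normal if, for each $k<p$, every $\sigma_i$ that is a left divisor of $s_{k+1}$ is a right divisor of $s_k$. Every $z\in B_n$ has a unique decomposition $z=\Delta_n^m s_1\cdots s_p$ with $m\in\mathbb Z$, $p\ge0$, and $(s_1,\dots,s_p)$ a normal sequence of simple braids with $s_1\ne\Delta_n$ and $s_p\ne1$ (no condition if $p=0$); $(m;s_1,\dots,s_p)$ is called the ($n$-)greedy normal form of $z$. The pairs in (i) and (ii) exist and are unique: every product of two simple braids can be written uniquely as $ab$ with $(a,b)$ a normal pair of simple braids; and for simple $s,t$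 the unique simple $s',t'$ with $s't=t's$ and $\gcd_L(s',t')=1$ are those with $s't=t's=\mathrm{lcm}_L(s,t)$. *)

(* Defs.v *)
From HB Require Import structures.
From mathcomp Require Import all_boot all_order all_algebra.
From mathcomp Require Import boolp.

Set Implicit Arguments.
Unset Strict Implicit.
Unset Printing Implicit Defensive.

Import IntDist.

Local Open Scope quotient_scope.
Local Open Scope group_scope.

(* Words in the letters sigma_1^{+-1}, ..., sigma_{n-1}^{+-1}: the index         *)
(* i : 'I_n.-1 is 0-based, so (i, true) stands for sigma_{i+1} and (i, false) for *)
(* its inverse.                                                                   *)
Definition word (n : nat) : Type := seq ('I_n.-1 * bool).

Inductive braid_eq (n : nat) : word n -> word n -> Prop :=
| BraidRefl w : braid_eq w w
| BraidSym w1 w2 : braid_eq w1 w2 -> braid_eq w2 w1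
| BraidTrans w1 w2 w3 : braid_eq w1 w2 -> braid_eq w2 w3 -> braid_eq w1 w3
| BraidCat u1 u2 v1 v2 :
    braid_eq u1 u2 -> braid_eq v1 v2 -> braid_eq (u1 ++ v1) (u2 ++ v2)
| BraidInv (i : 'I_n.-1) (b : bool) : braid_eq [:: (i, b); (i, ~~ b)] [::]
| BraidFar (i j : 'I_n.-1) : (2 <= `|i - j|)%N ->
    braid_eq [:: (i, true); (j, true)] [:: (j, true); (i, true)]
| BraidNear (i j : 'I_n.-1) : `|i - j|%N = 1%N ->
    braid_eq [:: (i, true); (j, true); (i, true)]
             [:: (j, true); (i, true); (j, true)].

Section BraidGroup.

Variable n : nat.

Definition braid_eqb (w1 w2 : word n) : bool := `[< braid_eq w1 w2 >].

Lemma braid_eqb_refl : reflexive braid_eqb.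
Proof. by move=> w; apply/asboolP/BraidRefl. Qed.

Lemma braid_eqb_sym : symmetric braid_eqb.
Proof. by move=> w1 w2; apply/asboolP/asboolP => /BraidSym. Qed.

Lemma braid_eqb_trans : transitive braid_eqb.
Proof.
by move=> w2 w1 w3 /asboolP h12 /asboolP h23; apply/asboolP/(BraidTrans h12 h23).
Qed.

Canonical braid_equiv :=
  EquivRel braid_eqb braid_eqb_refl braid_eqb_sym braid_eqb_trans.

Definition braid : Type := {eq_quot braid_equiv}.

HB.instance Definition _ := Choice.copy braid {eq_quot braid_equiv}.

Definition braid_of (w : word n) : braid := \pi_({eq_quot braid_equiv}) w.

Definition word_of (x : braid) : word n := repr (x : {eq_quot braid_equiv}).

Lemma word_ofK : cancel word_of braid_of.
Proof. by move=> x; exact: reprK. Qed.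

Lemma braid_ofP (w1 w2 : word n) : braid_of w1 = braid_of w2 <-> braid_eq w1 w2.
Proof.
split=> [/eqmodP h|h]; first exact/asboolP.
by apply/eqmodP/asboolP.
Qed.

Lemma braid_ofK (w : word n) : braid_eq (word_of (braid_of w)) w.
Proof. by apply/braid_ofP; rewrite word_ofK. Qed.

Definition inv_word (w : word n) : word n := rev [seq (l.1, ~~ l.2) | l <- w].

Lemma inv_wordK : involutive inv_word.
Proof.
move=> w; rewrite /inv_word map_rev revK -map_comp -[RHS]map_id.
by apply: eq_map => -[i b] /=; rewrite negbK.
Qed.

Lemma inv_word_mulV (w : word n) : braid_eq (w ++ inv_word w) [::].
Proof.
elim: w => [|[i b] w IHw]; first exact: BraidRefl.
rewrite /inv_word /= rev_cons -cats1 catA.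
apply: (BraidTrans _ (BraidInv i b)).
apply: (@BraidCat _ [:: (i, b)] [:: (i, b)]); first exact: BraidRefl.
by apply: (@BraidCat _ _ [::]); [exact: IHw | exact: BraidRefl].
Qed.

Lemma inv_word_mulVl (w : word n) : braid_eq (inv_word w ++ w) [::].
Proof. by have := inv_word_mulV (inv_word w); rewrite inv_wordK. Qed.

Definition braid_one : braid := braid_of [::].
Definition braid_mul (x y : braid) : braid := braid_of (word_of x ++ word_of y).
Definition braid_inv (x : braid) : braid := braid_of (inv_word (word_of x)).

Lemma braid_mulE (w1 w2 : word n) :
  braid_mul (braid_of w1) (braid_of w2) = braid_of (w1 ++ w2).
Proof. by apply/braid_ofP/BraidCat; exact: braid_ofK. Qed.

Lemma braid_mulA : associative braid_mul.
Proof.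
move=> x y z; rewrite -(word_ofK x) -(word_ofK y) -(word_ofK z).
by rewrite !braid_mulE catA.
Qed.

Lemma braid_mul1 : left_id braid_one braid_mul.
Proof. by move=> x; rewrite -(word_ofK x) braid_mulE. Qed.

Lemma braid_1mul : right_id braid_one braid_mul.
Proof. by move=> x; rewrite -(word_ofK x) braid_mulE cats0. Qed.

Lemma braid_mulV : left_inverse braid_one braid_inv braid_mul.
Proof.
move=> x; rewrite -[x in braid_mul _ x]word_ofK braid_mulE.
by apply/braid_ofP; exact: inv_word_mulVl.
Qed.

Lemma braid_Vmul : right_inverse braid_one braid_inv braid_mul.
Proof.
move=> x; rewrite -[x in braid_mul x _]word_ofK braid_mulE.
by apply/braid_ofP; exact: inv_word_mulV.
Qed.

HB.instance Definition _ := isGroup.Build braid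
  braid_mulA braid_mul1 braid_1mul braid_mulV braid_Vmul.

End BraidGroup.

Section Garside.

Variable n : nat.
Implicit Types (x y z d s t : braid n) (w : seq (braid n)).

(* sigma i is the Artin generator sigma_{i+1}. *)
Definition sigma (i : 'I_n.-1) : braid n := braid_of [:: (i, true)].

Lemma sigma_far (i j : 'I_n.-1) :
  (2 <= `|i - j|)%N -> sigma i * sigma j = sigma j * sigma i.
Proof.
by move=> h; rewrite [LHS]braid_mulE [RHS]braid_mulE; apply/braid_ofP/BraidFar.
Qed.

Lemma sigma_near (i j : 'I_n.-1) : `|i - j|%N = 1%N ->
  sigma i * sigma j * sigma i = sigma j * sigma i * sigma j.
Proof.
move=> h; rewrite [_ * sigma j in LHS]braid_mulE [LHS]braid_mulE.
rewrite [_ * sigma i in RHS]braid_mulE [RHS]braid_mulE.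
exact/braid_ofP/BraidNear.
Qed.

Inductive positive : braid n -> Prop :=
| Positive1 : positive 1
| PositiveSigma i : positive (sigma i)
| PositiveM x y : positive x -> positive y -> positive (x * y).

Definition left_divisor x y : Prop :=
  [/\ positive x, positive y & exists2 z, positive z & y = x * z].

Definition right_divisor x y : Prop :=
  [/\ positive x, positive y & exists2 z, positive z & y = z * x].

(* d is the greatest common left divisor of x and y. *)
Definition is_gcdL x y d : Prop :=
  [/\ left_divisor d x, left_divisor d y &
      forall e, left_divisor e x -> left_divisor e y -> left_divisor e d].

(* For 1 <= k <= n, Delta_rec k is the image of Delta_k in B_n; the 0-based      *)
(* ordinals i < k are those of sigma_1, ..., sigma_k.                            *)
Fixpoint Delta_rec (k : nat) : braid n :=
  if k is k'.+1 then (\prod_(i < n.-1 | (i < k')%N) sigma i) * Delta_rec k'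
  else 1.

Definition Delta : braid n := Delta_rec n.

Definition simple s : Prop := left_divisor s Delta.

(* The solution x of x * s = Delta, see lcomplE. *)
Definition lcompl s : braid n := Delta * s^-1.

Lemma lcomplE s x : x * s = Delta <-> x = lcompl s.
Proof.
by rewrite /lcompl; split=> [<-|->]; rewrite -mulgA ?mulgV ?mulVg mulg1.
Qed.

Definition normal_seq w : Prop :=
  (forall s, s \in w -> simple s) /\
  (forall k, (k.+1 < size w)%N ->
     forall i, left_divisor (sigma i) (nth 1 w k.+1) ->
               right_divisor (sigma i) (nth 1 w k)).

Definition expgz x (m : int) : braid n :=
  match m with Posz k => x ^+ k | Negz k => x ^- k.+1 end.

(* (m; w) is the greedy normal form of z. *)
Definition greedy_nf z (m : int) w : Prop :=
  [/\ z = expgz Delta m * \prod_(s <- w) s,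
      normal_seq w &
      w <> [::] -> head 1 w <> Delta /\ last 1 w <> 1].

(* The greedy normal form of z is (m; w) up to deleting the trailing 1's of w;   *)
(* all of them are deleted, since the last entry of a normal form is not 1.      *)
Definition greedy_nf_upto1 z (m : int) w : Prop :=
  exists (w' : seq (braid n)) (k : nat),
    w = w' ++ nseq k (1 : braid n) /\ greedy_nf z m w'.

End Garside.

Arguments Delta {n}.

(* Main.v *)
Require Import Defs.
From Corelib Require Import Setoid Morphisms.
From mathcomp Require Import all_boot all_order all_algebra.
From mathcomp Require Import all_fingroup zify boolp.

(** The proof is a short course in Garside theory for the submonoid of positive
braids, which here lives inside the group: cancellation is free, but to know
that two positive words are equal in B_n one must know that they are already
equal by positive braid relations.

The entries of the two recursions satisfy the product formula by telescoping:
s_1 ... s_p u_p = u_0 s'_1 ... s'_p in case (i). The point is that the new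
sequence is again normal. The pair (u_0, s'_1) is normal by construction, and
for the others the domino rule [normal_pair_domino] is needed: if
s_1 u_1 = u_0 s'_1 and s_2 u_2 = u_1 s'_2 with (s_1, s_2), (u_0, s'_1) and
(u_1, s'_2) normal, then (s'_1, s'_2) is normal. To see it, suppose that a
generator g divides s'_2 on the left but not s'_1 on the right. Since u_0 is the
largest simple left divisor of s_1 u_1, one has u_0 = s_1 t_1, and similarly
u_1 = s_2 t_2; hence u_1 g = t_1 (s'_1 g) = s_2 (t_2 g), where s'_1 g and t_2 g
are simple, and t_1, s_2 have no common left divisor because (s_1, s_2) is
normal and s_1 t_1 is simple. A common multiple of this kind is simple
([coprime_simple]), so u_1 g is simple. But g is a right divisor of u_1, because
(u_1, s'_2) is normal, and a simple braid has no square factor.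

This uses three facts on positive braids. The first is the existence of greatest
common left divisors ([gcdL_ex]); it rests on Garside's lemma, that a positive
word equal to words beginning with two given letters is equal to one beginning
with their least common multiple ([garside_diamond]), and on Garside's
embedding theorem ([pbraid_inj]). The second is that simple braids are exactly
the products of reduced words of permutations ([simpleP]), from Matsumoto's
theorem ([reduced_peq_perm]); it gives square-freeness, and that multiplying a
simple braid by a generator that does not divide it on that side keeps it
simple. The third is that Delta permutes the generators by conjugation, which
again follows from the reduced words of the longest permutation.

Case (ii) is case (i) in disguise: if v_i = u_i^-1 Delta is the complement of
u_i, the recursion of (ii) says that s_i v_i = v_{i-1} (s'_i)^Delta with
(v_{i-1}, (s'_i)^Delta) normal, and z u^-1 = z v_p Delta^-1. *)

Set Implicit Arguments.
Unset Strict Implicit.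
Unset Printing Implicit Defensive.

Local Open Scope group_scope.

(** * Positive words and Garside's lemma *)

Section PositiveWords.

Variable n : nat.
Implicit Types (i j k : 'I_n.-1) (w x y a b c : seq 'I_n.-1).

Definition far i j : bool := (i.+1 < j) || (j.+1 < i).
Definition near i j : bool := (i.+1 == j) || (j.+1 == i).

Lemma farC i j : far i j = far j i. Proof. exact: orbC. Qed.
Lemma nearC i j : near i j = near j i. Proof. exact: orbC. Qed.

Lemma letter_cases i j : [\/ i = j, far i j | near i j].
Proof.
rewrite /far /near; have [->|h] := eqVneq i j; first by constructor 1.
have {}h : (i : nat) <> j by move=> /val_inj e; rewrite e eqxx in h.
have [h1|h1] := boolP ((i.+1 < j) || (j.+1 < i)); first by constructor 2.
by constructor 3; lia.
Qed.

Lemma far_irrefl i : far i i = false. Proof. by rewrite /far; lia. Qed.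
Lemma near_irrefl i : near i i = false. Proof. by rewrite /near; lia. Qed.
Lemma far_near i j : far i j -> near i j -> False.
Proof. by rewrite /far /near; lia. Qed.
Lemma near_near_far i k j : near i k -> near k j -> i <> j -> far i j.
Proof.
move=> h1 h2 ne; have {}ne : (i : nat) <> j by move=> /val_inj.
by move: h1 h2; rewrite /near /far; lia.
Qed.

(** One application of a defining relation inside a positive word; [peq] is
equality in the monoid presented by the positive braid relations. It is kept
as a chain of steps because Garside's lemma is proved by induction on the
length of such a chain. *)
Inductive pstep : seq 'I_n.-1 -> seq 'I_n.-1 -> Prop :=
| PStepFar i j w : far i j -> pstep [:: i, j & w] [:: j, i & w]
| PStepNear i j w : near i j -> pstep [:: i, j, i & w] [:: j, i, j & w]
| PStepCons i w w' : pstep w w' -> pstep (i :: w) (i :: w').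

Inductive peq : seq 'I_n.-1 -> seq 'I_n.-1 -> Prop :=
| PEqRefl w : peq w w
| PEqStep w1 w2 w3 : pstep w1 w2 -> peq w2 w3 -> peq w1 w3.

End PositiveWords.

#[global] Hint Resolve PEqRefl : core.

Section PositiveEquality.

Variable n : nat.
Implicit Types (i j k : 'I_n.-1) (w x y a b c : seq 'I_n.-1).

Lemma pstep_sym w w' : pstep w w' -> pstep w' w.
Proof.
elim=> [i j u h|i j u h|i u u' _ IH].
- by apply: PStepFar; rewrite farC.
- by apply: PStepNear; rewrite nearC.
- exact: PStepCons.
Qed.

Lemma pstep_peq w w' : pstep w w' -> peq w w'.
Proof. by move=> h; apply: PEqStep h (PEqRefl _). Qed.

Lemma peq_trans w1 w2 w3 : peq w1 w2 -> peq w2 w3 -> peq w1 w3.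
Proof. by elim=> // u1 u2 u3 h _ IH /IH; apply: PEqStep. Qed.

Lemma peq_sym w1 w2 : peq w1 w2 -> peq w2 w1.
Proof.
elim=> [w|u1 u2 u3 h _ IH]; first exact: PEqRefl.
by apply: (peq_trans IH); apply: pstep_peq; apply: pstep_sym.
Qed.

Lemma peq_cons i w w' : peq w w' -> peq (i :: w) (i :: w').
Proof.
elim=> [u|u1 u2 u3 h _ IH]; first exact: PEqRefl.
by apply: PEqStep IH; apply: PStepCons.
Qed.

Lemma peq_catl w x y : peq x y -> peq (w ++ x) (w ++ y).
Proof. by move=> h; elim: w => //= i w; apply: peq_cons. Qed.

Lemma pstep_catr w x y : pstep x y -> pstep (x ++ w) (y ++ w).
Proof.
by elim=> /= *; [apply: PStepFar|apply: PStepNear|apply: PStepCons].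
Qed.

Lemma peq_catr w x y : peq x y -> peq (x ++ w) (y ++ w).
Proof.
elim=> [u|u1 u2 u3 h _ IH]; first exact: PEqRefl.
by apply: PEqStep IH; apply: pstep_catr.
Qed.

#[global] Instance peq_equiv : Equivalence (@peq n).
Proof.
split; [exact: PEqRefl | exact: peq_sym | by move=> ? ? ?; apply: peq_trans].
Qed.

#[global] Instance peq_cons_proper i : Proper (@peq n ==> @peq n) (cons i).
Proof. by move=> x y; apply: peq_cons. Qed.

#[global] Instance peq_cat_proper : Proper (@peq n ==> @peq n ==> @peq n) cat.
Proof.
by move=> x x' hx y y' hy; apply: peq_trans (peq_catr _ hx) (peq_catl _ hy).
Qed.

Lemma peq_far i j w : far i j -> peq [:: i, j & w] [:: j, i & w].
Proof. by move=> h; apply/pstep_peq/PStepFar. Qed.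

Lemma peq_near i j w : near i j -> peq [:: i, j, i & w] [:: j, i, j & w].
Proof. by move=> h; apply/pstep_peq/PStepNear. Qed.

Lemma peq_size x y : peq x y -> size x = size y.
Proof.
by elim=> // u1 u2 u3 h _ <-; elim: h => //= i w w' _ ->.
Qed.

(** What Garside's lemma asserts of two equal words [i :: x] and [j :: y]: both
begin with the least common multiple of [i] and [j], whose shape depends on how
far apart the two letters are. *)
Definition diamond i j x y : Prop :=
  [\/ i = j /\ peq x y,
      far i j /\ (exists z, peq x (j :: z) /\ peq y (i :: z)) |
      near i j /\ (exists z, peq x [:: j, i & z] /\ peq y [:: i, j & z])].

Lemma diamond_sym i j x y : diamond i j x y -> diamond j i y x.
Proof.
case=> [[-> h]|[h [z [h1 h2]]]|[h [z [h1 h2]]]].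
- by constructor 1; split; last apply: peq_sym.
- by constructor 2; rewrite farC; split=> //; exists z.
- by constructor 3; rewrite nearC; split=> //; exists z.
Qed.

Lemma diamondxx i x y : diamond i i x y -> peq x y.
Proof. by case=> [[]|[]|[]] //; rewrite ?far_irrefl ?near_irrefl. Qed.

Lemma diamond_far i j x y : far i j -> diamond i j x y ->
  exists z, peq x (j :: z) /\ peq y (i :: z).
Proof.
move=> h [[e]|[_]|[/(far_near h)]] //.
by move: h; rewrite e far_irrefl.
Qed.

Lemma diamond_near i j x y : near i j -> diamond i j x y ->
  exists z, peq x [:: j, i & z] /\ peq y [:: i, j & z].
Proof.
move=> h [[e]|[/far_near/(_ h)]|[_]] //.
by move: h; rewrite e near_irrefl.
Qed.

(** Two diamonds that share a word can be pasted, provided that Garside's lemma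
holds for shorter words: the shared word [k :: w] begins with two least common
multiples, and applying the lemma to what follows fills the cube on the letters
[i], [k], [j]. The only laborious cube is that of letters [i], [k] adjacent and
[k], [j] commuting. *)
Section DiamondTrans.

Variable L : nat.
Hypothesis IHL : forall i j x y, size x < L -> peq (i :: x) (j :: y) ->
  diamond i j x y.

Lemma diamond_trans_near_far i k j x w y : size w = L ->
  near i k -> far k j -> i <> j ->
  diamond i k x w -> diamond k j w y -> diamond i j x y.
Proof.
move=> sw nik fkj ne /(diamond_near nik)[z [ex ew]].
move=> /(diamond_far fkj)[z' [ew' ey]].
have e1 : peq [:: i, k & z] (j :: z') by rewrite -ew -ew'.
have sz : (size z).+2 = L by rewrite -sw (peq_size ew).
case: (letter_cases i j) => [//|fij|nij].
- have [|v [e2 e3]] := diamond_far fij (IHL _ e1); first by rewrite /=; lia.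
  have [|u [e4 e5]] := diamond_far fkj (IHL _ e2); first by rewrite /=; lia.
  constructor 2; split=> //; exists [:: k, i & u]; split.
    rewrite ex e4 (peq_far _ fij); exact: peq_far.
  by rewrite ey e3 e5; rewrite nearC in nik; exact: peq_near.
- have [|v [e2 e3]] := diamond_near nij (IHL _ e1); first by rewrite /=; lia.
  have [|u [e4 e5]] := diamond_far fkj (IHL _ e2); first by rewrite /=; lia.
  have sv : (size v).+2 = (size z).+1 by have /= := peq_size e2; lia.
  have [|t [e6 e7]] := diamond_near nik (IHL _ e5); first by rewrite /=; lia.
  have fjk : far j k by rewrite farC.
  have nki : near k i by rewrite nearC.
  constructor 3; split=> //; exists [:: k, i, j & t]; split.
    rewrite ex e4 e7 (peq_near _ nij) (peq_far _ fkj) (peq_far t fjk).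
    by rewrite (peq_near _ nki).
  rewrite ey e3 e6 (peq_far _ fjk) (peq_near _ nki) (peq_near _ nij).
  by rewrite (peq_far _ fkj).
Qed.

Lemma diamond_trans i k j x w y : size w = L -> size x = L -> size y = L ->
  diamond i k x w -> diamond k j w y -> diamond i j x y.
Proof.
move=> sw sx sy dik dkj.
have [eij|nij] := eqVneq i j.
  subst j; constructor 1; split=> //.
  case: (letter_cases i k) => [eik|fik|nik].
  - by subst k; rewrite (diamondxx dik) (diamondxx dkj).
  - have [z [ex ew]] := diamond_far fik dik.
    rewrite farC in fik; have [z' [ew' ey]] := diamond_far fik dkj.
    suff e : peq z z' by rewrite ex e ey.
    apply: (@diamondxx i); apply: IHL; last by rewrite -ew.
    by have := peq_size ew; rewrite /=; lia.
  - have [z [ex ew]] := diamond_near nik dik.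
    rewrite nearC in nik; have [z' [ew' ey]] := diamond_near nik dkj.
    suff e : peq z z' by rewrite ex e ey.
    apply: (@diamondxx k); apply: IHL.
      by have := peq_size ew; rewrite /=; lia.
    apply: (@diamondxx i); apply: IHL; last by rewrite -ew.
    by have := peq_size ew; rewrite /=; lia.
move/eqP: nij => nij.
case: (letter_cases i k) => [eik|fik|nik].
- subst k; have e := diamondxx dik.
  case: dkj => [[//]|[h [z [h1 h2]]]|[h [z [h1 h2]]]].
    by constructor 2; split=> //; exists z; rewrite e.
  by constructor 3; split=> //; exists z; rewrite e.
- case: (letter_cases k j) => [ekj|fkj|nkj].
  + subst k; have e := diamondxx dkj.
    by constructor 2; split=> //; have [z] := diamond_far fik dik;
      exists z; rewrite -e.
  + have [z [ex ew]] := diamond_far fik dik.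
    have [z' [ew' ey]] := diamond_far fkj dkj.
    have sz : size z < L by have /= := peq_size ew; lia.
    have e1 : peq (i :: z) (j :: z') by rewrite -ew -ew'.
    have fjk : far j k by rewrite farC.
    have fki : far k i by rewrite farC.
    case: (IHL sz e1) => [[//]|[h [u [h1 h2]]]|[h [u [h1 h2]]]].
      constructor 2; split=> //; exists (k :: u).
      by rewrite ex ey h1 h2 (peq_far _ fkj) (peq_far _ fki).
    constructor 3; split=> //; exists (k :: u).
    rewrite ex ey h1 h2 (peq_far _ fkj) (peq_far _ fki) (peq_far _ fki).
    by rewrite (peq_far _ fkj).
  + apply: diamond_sym.
    apply: (@diamond_trans_near_far j k i y w x) => //.
    * by rewrite nearC.
    * by rewrite farC.
    * by move=> e; apply: nij.
    * exact: diamond_sym.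
    * exact: diamond_sym.
- case: (letter_cases k j) => [ekj|fkj|nkj].
  + subst k; have e := diamondxx dkj.
    by constructor 3; split=> //; have [z] := diamond_near nik dik;
      exists z; rewrite -e.
  + exact: diamond_trans_near_far nik fkj nij dik dkj.
  + have fij := near_near_far nik nkj nij.
    have [z [ex ew]] := diamond_near nik dik.
    have [z' [ew' ey]] := diamond_near nkj dkj.
    have sz : (size z).+2 = L by have /= := peq_size ew; lia.
    have sz' : (size z').+2 = L by have /= := peq_size ew'; lia.
    have e1 : peq [:: i, k & z] [:: j, k & z'] by rewrite -ew -ew'.
    have [|v [e2 e3]] := diamond_far fij (IHL _ e1); first by rewrite /=; lia.
    have [|u [e4 e5]] := diamond_near nkj (IHL _ e2); first by rewrite /=; lia.
    rewrite nearC in nik.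
    have [|t [e6 e7]] := diamond_near nik (IHL _ e3); first by rewrite /=; lia.
    have e8 : peq [:: j & u] [:: i & t].
      apply: (@diamondxx k); apply: IHL; first by have /= := peq_size e4; lia.
      by rewrite -e5 -e7.
    rewrite farC in fij.
    have [|s [e9 e10]] := diamond_far fij (IHL _ e8).
      by have /= := peq_size e4; lia.
    constructor 2; split; first by rewrite farC.
    have njk : near j k by rewrite nearC.
    have nki : near i k by rewrite nearC.
    exists [:: k, j, i, k & s]; split.
      by rewrite ex e4 e9 -(peq_far _ fij) (peq_near _ nki) (peq_near _ nkj).
    rewrite ey e6 e10 (peq_far _ fij) (peq_near _ njk) (peq_near _ nik).
    by rewrite -(peq_far _ fij).
Qed.

End DiamondTrans.

(** Garside's lemma, by induction on the length of the words and then on the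
chain of relations that joins them: a step that leaves the first letter alone is
a trivial diamond, a step that changes it is an explicit one, and
[diamond_trans] pastes it to the diamond of the rest of the chain. *)
Lemma garside_diamond i j x y : peq (i :: x) (j :: y) -> diamond i j x y.
Proof.
move: {2}(size x).+1 (ltnSn (size x)) => L.
elim: L i j x y => // L IHL i j x y.
rewrite ltnS leq_eqVlt => /orP[/eqP sx|]; last by move=> h1 h2; apply: IHL.
suff gen a b : peq a b -> forall i j x y, size x = L ->
    a = i :: x -> b = j :: y -> diamond i j x y by move/gen; apply.
elim=> [w|w1 w2 w3 h12 h23 IH] {sx} {}i {}j {}x {}y sx ea eb.
  by move: ea; rewrite eb => -[-> ->]; constructor 1; split=> //; reflexivity.
have sy : size y = L.
  by have := peq_size (PEqStep h12 h23); rewrite ea eb /= sx => -[].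
case: h12 ea h23 IH => [i' k w f|i' k w f|i' w w' h12] [? ex] h23 IH; subst i'.
- apply: (@diamond_trans L _ i k j x (i :: w) y) => //.
  + by rewrite -sx -ex.
  + by constructor 2; split=> //; exists w; rewrite -ex; split; reflexivity.
  + by apply: IH => //; rewrite -sx -ex.
- apply: (@diamond_trans L _ i k j x [:: i, k & w] y) => //.
  + by rewrite -sx -ex.
  + by constructor 3; split=> //; exists w; rewrite -ex; split; reflexivity.
  + by apply: IH => //; rewrite -sx -ex.
- have e : peq x w' by rewrite -ex; apply: pstep_peq.
  apply: (@diamond_trans L _ i i j x w' y) => //.
  + by rewrite -sx (peq_size e).
  + by constructor 1.
  + by apply: IH => //; rewrite -sx (peq_size e).
Qed.

Lemma peq_cancel w x y : peq (w ++ x) (w ++ y) -> peq x y.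
Proof. by elim: w => //= i w IH /garside_diamond/diamondxx/IH. Qed.

End PositiveEquality.

(** * Reduced words of permutations *)

Section ReducedWords.

Variable n : nat.
Implicit Types (i j k : 'I_n.-1) (w x y a b c : seq 'I_n.-1) (s t : 'S_n).

Lemma succ_lt i : i.+1 < n. Proof. by have := ltn_ord i; lia. Qed.

Definition lo i : 'I_n := Ordinal (ltnW (succ_lt i)).
Definition hi i : 'I_n := Ordinal (succ_lt i).
Definition adj i : 'S_n := tperm (lo i) (hi i).
Definition wperm w : 'S_n := \prod_(i <- w) adj i.
Definition ascent s i : bool := s (lo i) < s (hi i).

(** In mathcomp the product [s * t] applies [s] first, so multiplying on the left
by an adjacent transposition exchanges two neighbouring values of a permutation.
A word is reduced when each of its letters, read from the right, creates an
inversion. *)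
Fixpoint reduced w : bool :=
  if w is i :: w' then ascent (wperm w') i && reduced w' else true.

Lemma wperm_cons i w : wperm (i :: w) = adj i * wperm w.
Proof. by rewrite /wperm big_cons. Qed.

Lemma wperm_cat w x : wperm (w ++ x) = wperm w * wperm x.
Proof. by rewrite /wperm big_cat. Qed.

Lemma adjK i s : adj i * (adj i * s) = s.
Proof. by rewrite mulgA tperm2 mul1g. Qed.

Lemma adj_lo i s : (adj i * s) (lo i) = s (hi i).
Proof. by rewrite permM tpermL. Qed.

Lemma adj_hi i s : (adj i * s) (hi i) = s (lo i).
Proof. by rewrite permM tpermR. Qed.

Lemma adj_out i (p : 'I_n) : p != i :> nat -> p != i.+1 :> nat -> adj i p = p.
Proof. by move=> h1 h2; rewrite tpermD // -val_eqE /= eq_sym. Qed.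

Lemma descentE i s : ~~ ascent s i = (s (hi i) < s (lo i)).
Proof.
have : val (s (hi i)) != s (lo i).
  by rewrite val_eqE (inj_eq perm_inj) -val_eqE /=; lia.
by rewrite /ascent /=; lia.
Qed.

Lemma ascent_adj i s : ascent (adj i * s) i = ~~ ascent s i.
Proof. by rewrite descentE /ascent adj_lo adj_hi. Qed.

Lemma ascent_far i j s : far i j -> ascent (adj j * s) i = ascent s i.
Proof.
by rewrite /far /ascent => h; rewrite !permM !adj_out //=; lia.
Qed.

Lemma adj_far i j : far i j -> adj i * adj j = adj j * adj i.
Proof.
rewrite /far => h; rewrite conjgC; congr (_ * _).
by rewrite tpermJ !adj_out //=; lia.
Qed.

Lemma hi_lo i j : i.+1 = j -> hi i = lo j.
Proof. by move=> e; apply: val_inj. Qed.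

Lemma adj_near i j : near i j -> adj i * adj j * adj i = adj j * adj i * adj j.
Proof.
wlog e : i j / i.+1 = j.
  move=> wl h; case/orP: (h) => /eqP e; first exact: wl.
  by symmetry; apply: wl; rewrite // nearC.
move=> _; have -> : adj i * adj j * adj i = adj j ^ adj i.
  by rewrite conjgE tpermV mulgA.
have -> : adj j * adj i * adj j = adj i ^ adj j by rewrite conjgE tpermV mulgA.
rewrite !tpermJ (hi_lo e) tpermL -(hi_lo e) tpermR !adj_out //=; lia.
Qed.

(** Adjacency is symmetric but the positions it compares are ordered; this splits
a statement on adjacent letters into its two orientations. *)
Lemma near_wlog (P : 'I_n.-1 -> 'I_n.-1 -> Prop) :
  (forall i j, i.+1 = j -> P i j /\ P j i) -> forall i j, near i j -> P i j.
Proof. by move=> h i j /orP[]/eqP/h[]. Qed.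

(** The three lemmas on adjacent letters compare pairs among three consecutive
values [a], [b], [c] of [s]: the first keeps track of an adjacent pair moved
by two exchanges, the second of the pair [a], [c], and the third is the
transitivity of the order. *)
Lemma ascent_near2 i j s : near i j ->
  ascent (adj i * (adj j * s)) j = ascent s i.
Proof.
move: i j; apply: near_wlog => i j e; have elh := hi_lo e.
have e1 t : (adj j * t) (lo i) = t (lo i) by rewrite permM adj_out //=; lia.
have e2 t : (adj i * t) (hi j) = t (hi j) by rewrite permM adj_out //=; lia.
split; rewrite /ascent; first by rewrite -elh adj_hi e1 e2 elh adj_hi.
by rewrite e1 adj_lo elh adj_lo e2.
Qed.

Lemma ascent_near1 i j s : near i j ->
  ascent (adj i * s) j = ascent (adj j * s) i.
Proof.
move: i j; apply: near_wlog => i j e; have elh := hi_lo e.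
have e1 t : (adj j * t) (lo i) = t (lo i) by rewrite permM adj_out //=; lia.
have e2 t : (adj i * t) (hi j) = t (hi j) by rewrite permM adj_out //=; lia.
split; rewrite /ascent; last by rewrite elh adj_lo e1 e2 -elh adj_hi.
by rewrite e1 e2 -elh adj_hi elh adj_lo.
Qed.

Lemma descent_near i j s : near i j -> ~~ ascent s i -> ~~ ascent s j ->
  ~~ ascent (adj i * s) j.
Proof.
move: i j; apply: near_wlog => i j e; have elh := hi_lo e.
have e1 t : (adj j * t) (lo i) = t (lo i) by rewrite permM adj_out //=; lia.
have e2 t : (adj i * t) (hi j) = t (hi j) by rewrite permM adj_out //=; lia.
by split; rewrite !descentE ?e1 ?e2 -elh ?adj_hi elh ?adj_lo; lia.
Qed.

Lemma wperm_pstep w x : pstep w x -> wperm w = wperm x.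
Proof.
elim=> [i j u h|i j u h|i u u' _ IH]; rewrite !wperm_cons ?IH // !mulgA.
  by rewrite adj_far.
by rewrite adj_near.
Qed.

Lemma reduced_pstep w x : pstep w x -> reduced w = reduced x.
Proof.
elim=> [i j u h|i j u h|i u u' h IH] /=; last by rewrite IH (wperm_pstep h).
  rewrite !wperm_cons ascent_far // ascent_far; last by rewrite farC.
  by rewrite andbCA.
rewrite !wperm_cons !ascent_near2 //; last by rewrite nearC.
by rewrite ascent_near1 //; do 3?case: (ascent _ _).
Qed.

Lemma reduced_peq w x : peq w x -> reduced w = reduced x.
Proof. by elim=> // u1 u2 u3 /reduced_pstep-> _ ->. Qed.

Lemma reduced_catr w x : reduced (w ++ x) -> reduced x.
Proof. by elim: w => //= i w IH /andP[_]. Qed.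

Lemma sum_adj (f : nat -> nat) i s :
  \sum_(p < n) f p * (adj i * s)%g p + (f i * s (lo i) + f i.+1 * s (hi i)) =
  \sum_(p < n) f p * s p + (f i * s (hi i) + f i.+1 * s (lo i)).
Proof.
have split2 t : \sum_(p < n) f p * t p =
    (f i * t (lo i) + f i.+1 * t (hi i) +
     \sum_(p < n | (p != lo i) && (p != hi i)) f p * t p)%N.
  rewrite (bigD1 (lo i)) //= (bigD1 (hi i)) /= ?addnA //.
  by rewrite -val_eqE /=; lia.
rewrite !split2 adj_lo adj_hi.
rewrite [X in (_ + X + _)%N](_ : _ =
  \sum_(p < n | (p != lo i) && (p != hi i)) f p * s p); first by lia.
apply: eq_bigr => p /andP[h1 h2].
by rewrite permM adj_out.
Qed.

(** An increasing map of an interval into itself lies above the identity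
(counting from the left end) and below it (counting from the right end). *)
Lemma no_descent_eq1 s : (forall i, ascent s i) -> s = 1.
Proof.
move=> h; have at_hi (p : 'I_n) : 0 < p -> exists i, hi i = p.
  move=> hp; have hp1 : p.-1 < n.-1 by have := ltn_ord p; lia.
  by exists (Ordinal hp1); apply: val_inj => /=; lia.
have at_lo (p : 'I_n) : p.+1 < n -> exists i, lo i = p.
  move=> hp; have hp1 : p < n.-1 by lia.
  by exists (Ordinal hp1); apply: val_inj.
have up q (p : 'I_n) : p = q :> nat -> q <= s p.
  elim: q p => // q IH p e; have [|i ei] := at_hi p; first by lia.
  have := h i; have := IH (lo i); rewrite /ascent ei.
  by move: e; rewrite -ei /= => e /(_ (succn_inj e)); lia.
have dn q (p : 'I_n) : p + q = n.-1 -> s p + q <= n.-1.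
  elim: q p => [|q IH] p e; first by have := ltn_ord (s p); lia.
  have [|i ei] := at_lo p; first by lia.
  have := h i; have := IH (hi i); rewrite /ascent ei.
  move: e; rewrite -ei /= => e; have e' : i.+1 + q = n.-1 by lia.
  by move/(_ e'); lia.
apply/permP => p; rewrite perm1; apply: val_inj => /=.
have := up p p erefl; have := dn (n.-1 - p) p; have := ltn_ord p; lia.
Qed.

Lemma descent_ex s : s <> 1 -> exists i, ~~ ascent s i.
Proof.
move=> h; apply/existsP; rewrite -[X in is_true X]negbK negb_exists.
by apply/negP => /forallP h1; apply: h; apply: no_descent_eq1 => i;
  rewrite -[ascent _ _]negbK.
Qed.

(** A weight that drops at each exchange of a descent; it replaces the number of
inversions as a termination measure. *)
Definition weight s : nat := \sum_(p < n) (n - p) * s p.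

Lemma weight_descent i s : ~~ ascent s i -> weight (adj i * s) < weight s.
Proof.
have /= := sum_adj (subn n) i s; rewrite descentE -/(weight s).
rewrite -/(weight (adj i * s)).
have -> : n - i = (n - i.+1).+1 by have := succ_lt i; lia.
rewrite !mulSn; move: (weight _) (weight _) (_ * _)%N (_ * _)%N => X Y u v.
by move: (nat_of_ord (s (lo i))) (nat_of_ord (s (hi i))) => a b; lia.
Qed.

Lemma reduced_word_ex s : exists2 w, reduced w & wperm w = s.
Proof.
have [m] := ubnP (weight s); elim: m s => // m IH s.
rewrite ltnS => hm; have [->|/eqP/descent_ex[i di]] := eqVneq s 1.
  by exists [::] => //; rewrite /wperm big_nil.
have [|w hw ew] := IH (adj i * s).
  exact: leq_trans (weight_descent di) hm.
by exists (i :: w); rewrite /= ?wperm_cons ew ?adjK // ascent_adj di.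
Qed.

(** Matsumoto's theorem. If the words begin with different letters [i] and [j],
their permutation has descents at both, hence is the product of the longest
permutation on [i], [j] and of one with a reduced word [c]. Both words are then
compared with the two words of that longest permutation followed by [c].
The induction is on the length of the first word only: the equality of the
first tail with its counterpart bounds the length of [c]. *)
Lemma reduced_peq_perm x y :
  reduced x -> reduced y -> wperm x = wperm y -> peq x y.
Proof.
have [m] := ubnP (size x); elim: m x y => // m IH x y.
have nil_cons i z : reduced (i :: z) -> wperm [::] <> wperm (i :: z).
  move=> /=/andP[h _] e; have : ascent (wperm (i :: z)) i.
    by rewrite -e /wperm big_nil /ascent !perm1.
  by rewrite wperm_cons ascent_adj h.
case: x => [|i x]; case: y => [|j y] //.
- by move=> _ _ /nil_cons h /h.
- by move=> _ /nil_cons h _ /esym/h.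
rewrite ltnS /= => hm /[dup] rx /=/andP[ai rx'] /[dup] ry /=/andP[aj ry'] e.
have di : ~~ ascent (wperm (i :: x)) i by rewrite wperm_cons ascent_adj ai.
have dj : ~~ ascent (wperm (i :: x)) j by rewrite e wperm_cons ascent_adj aj.
have ex : wperm x = adj i * wperm (i :: x) by rewrite wperm_cons adjK.
have ey : wperm y = adj j * wperm (i :: x) by rewrite e wperm_cons adjK.
case: (letter_cases i j) => [eij|fij|nij].
- by subst j; apply: peq_cons; apply: IH => //; rewrite ex ey.
- have [c rc ec] := reduced_word_ex (adj j * (adj i * wperm (i :: x))).
  have rjc : reduced (j :: c).
    by rewrite /= rc ec ascent_adj ascent_far ?dj // farC.
  have h1 : peq x (j :: c).
    by apply: IH => //; rewrite wperm_cons ec adjK ex.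
  have rijc : reduced [:: i, j & c] by rewrite -(reduced_peq (peq_cons i h1)).
  have h2 : peq (i :: c) y.
    apply: IH => //; first by have /= := peq_size h1; lia.
      by move: rijc; rewrite (reduced_peq (peq_far _ fij)) => /=/andP[].
    by rewrite ey wperm_cons ec !mulgA (adj_far fij) -!mulgA adjK.
  by rewrite h1 (peq_far _ fij) h2.
- have nji : near j i by rewrite nearC.
  have [c rc ec] := reduced_word_ex (adj i * (adj j * (adj i * wperm (i :: x)))).
  have rjic : reduced [:: j, i & c].
    rewrite /= rc wperm_cons ec adjK !ascent_adj ascent_near2 // dj.
    by rewrite (negbTE (descent_near _ di dj)).
  have h1 : peq x [:: j, i & c].
    by apply: IH => //; rewrite 2!wperm_cons ec !adjK.
  have rijic : reduced [:: i, j, i & c] by rewrite -(reduced_peq (peq_cons i h1)).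
  have h2 : peq [:: i, j & c] y.
    apply: IH => //; first by have /= := peq_size h1; lia.
      by move: rijic; rewrite (reduced_peq (peq_near _ nij)) => /=/andP[].
    by rewrite 2!wperm_cons ec !mulgA (adj_near nij) -!mulgA !adjK ey.
  by rewrite h1 (peq_near _ nij) h2.
Qed.

(** Reduced words are the shortest words of a permutation. This is how reducedness
can be checked when a letter is added on the right, where the definition gives
no direct access. *)
Lemma reduced_size x y : reduced y -> wperm x = wperm y ->
  size y <= size x /\ (size x <= size y -> reduced x).
Proof.
elim: x y => [|i x IH] y ry e.
  by have := peq_size (reduced_peq_perm (isT : reduced [::]) ry e) => <-.
have [c rc ec] := reduced_word_ex (wperm x).
have [h1 h2] := IH c rc (esym ec).
have [ai|di] := boolP (ascent (wperm x) i).
  have ric : reduced (i :: c) by rewrite /= ec ai.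
  have := peq_size (reduced_peq_perm ric ry _).
  rewrite wperm_cons ec -wperm_cons => /(_ e) /= es.
  by split=> [|h] /=; [lia | rewrite ai h2 //; lia].
have riy : reduced (i :: y) by rewrite /= ry -e wperm_cons ascent_adj di.
have := peq_size (reduced_peq_perm riy rc _).
rewrite wperm_cons -e wperm_cons adjK => /(_ (esym ec)) /= es.
by split=> [|h]; lia.
Qed.

Definition wrev : 'S_n := perm (can_inj (@rev_ordK n)).

Lemma ascent_rev i s : ascent (s * wrev) i = ~~ ascent s i.
Proof.
rewrite descentE /ascent !permM !permE /=.
by have := ltn_ord (s (hi i)); have := ltn_ord (s (lo i)); lia.
Qed.

Lemma no_ascent_eq_rev s : (forall i, ~~ ascent s i) -> s = wrev.
Proof.
move=> h; have e : s * wrev = 1.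
  by apply: no_descent_eq1 => i; rewrite ascent_rev.
have e2 : wrev * wrev = 1.
  by apply/permP => p; rewrite permM !permE rev_ordK.
by apply: (mulIg wrev); rewrite e e2.
Qed.

Lemma reduced_extend w : reduced w ->
  exists c, reduced (c ++ w) /\ wperm (c ++ w) = wrev.
Proof.
have [m] := ubnP (weight (wperm w * wrev)).
elim: m w => // m IH w; rewrite ltnS => hm rw.
have [/forallP h|] := boolP [forall i, ~~ ascent (wperm w) i].
  by exists [::]; split=> //; apply: no_ascent_eq_rev.
rewrite negb_forall => /existsP[i]; rewrite negbK => ai.
have [||c [h1 h2]] := IH (i :: w); last 1 first.
- by exists (rcons c i); rewrite cat_rcons.
- apply: leq_trans hm; rewrite wperm_cons -mulgA; apply: weight_descent.
  by rewrite ascent_rev ai.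
- by rewrite /= ai.
Qed.

(** The origin of the conjugation action of Delta on the generators. *)
Lemma adj_wrev i : adj i * wrev = wrev * adj (rev_ord i).
Proof.
rewrite conjgC tpermJ tpermC; congr (_ * tperm _ _); apply: val_inj;
  by rewrite permE /=; have := ltn_ord i; lia.
Qed.

Fixpoint delta_word (k : nat) : seq 'I_n.-1 :=
  if k is k'.+1 then [seq i : 'I_n.-1 <- enum 'I_n.-1 | i < k'] ++ delta_word k'
  else [::].

(** The cycle that completes the reversal of [k] points to that of [k.+1] points,
one letter at a time from the right: the letters [j], ..., [k.-1] move the value
[k] from position [k] down to position [j]. *)
Lemma delta_word_step (k : nat) l a (j m : nat) :
  map val l = iota j m -> j + m = k -> k < n -> reduced a ->
  (forall p : 'I_n, wperm a p = (if p < k then k.-1 - p else p) :> nat) ->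
  reduced (l ++ a) /\
  (forall p : 'I_n, wperm (l ++ a) p =
     (if p < j then k.-1 - p else if p == j :> nat then k
      else if p <= k then k - p else p) :> nat).
Proof.
move=> + + hk ra ea; elim: l j m => [|i l IH] j [|m] //=.
  by rewrite addn0 => _ ->; split=> // p; rewrite ea; case: ltngtP => //.
move=> [ei el] ejm; have [|rl ep] := IH _ _ el; first by lia.
split.
  by rewrite rl andbT /ascent !ep /= ei ltnSn ltnn eqxx; lia.
move=> p; rewrite wperm_cons permM ep.
have [->|nlo] := eqVneq p (lo i); first by rewrite tpermL /= ei ltnn !eqxx ltnn.
have [->|nhi] := eqVneq p (hi i); first by
  rewrite tpermR /= ei ltnSn; do ![case: ifP => ?]; lia.
rewrite tpermD 1?eq_sym //; move: nlo nhi; rewrite -!val_eqE /= ei.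
by do ![case: ifP => ?]; lia.
Qed.

Lemma delta_word_spec (k : nat) : k <= n ->
  reduced (delta_word k) /\
  (forall p : 'I_n,
     wperm (delta_word k) p = (if p < k then k.-1 - p else p) :> nat).
Proof.
elim: k => [|k IH] hk.
  by split=> // p; rewrite /wperm big_nil perm1.
have [r e] := IH (ltnW hk).
have [|//|//|//|//|r' e'] := @delta_word_step k
  [seq i : 'I_n.-1 <- enum 'I_n.-1 | i < k] (delta_word k) 0 k.
- rewrite -(filter_map val (fun m => m < k)) val_enum_ord.
  by apply: (@filter_iota_ltn 0); lia.
by split=> // p; rewrite e' /=; do ![case: ifP => ?]; lia.
Qed.

Definition twist_word : seq 'I_n.-1 := delta_word n.

Lemma reduced_delta : reduced twist_word.
Proof. by case: (delta_word_spec (leqnn n)). Qed.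

Lemma wperm_delta : wperm twist_word = wrev.
Proof.
apply/permP => p; apply: val_inj; rewrite permE /=.
by have [_ ->] := delta_word_spec (leqnn n); rewrite ltn_ord; lia.
Qed.

Lemma co_letter_ex i :
  exists c, reduced c && (wperm c == adj i * wrev).
Proof.
by have [c rc ec] := reduced_word_ex (adj i * wrev); exists c; rewrite rc ec /=.
Qed.

(** What remains of Delta after an initial letter [i]. *)
Definition co_letter i : seq 'I_n.-1 := xchoose (co_letter_ex i).

Lemma peq_co_letter i : peq (i :: co_letter i) twist_word /\
  peq (rcons (co_letter i) (rev_ord i)) twist_word.
Proof.
rewrite /co_letter.
move: (xchoose _) (xchooseP (co_letter_ex i)) => c /andP[rc /eqP ec].
have dn : ~~ ascent wrev i.
  by rewrite descentE !permE /=; have := ltn_ord i; lia.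
have h1 : peq (i :: c) twist_word.
  apply: reduced_peq_perm; rewrite ?reduced_delta //=.
    by rewrite rc ec ascent_adj dn.
  by rewrite wperm_cons ec adjK wperm_delta.
split=> //; have e : wperm (rcons c (rev_ord i)) = wperm twist_word.
  rewrite -cats1 wperm_cat ec wperm_cons /wperm big_nil mulg1.
  by rewrite -mulgA -adj_wrev adjK -wperm_delta.
apply: reduced_peq_perm => //; last exact: reduced_delta.
have [_ ->//] := reduced_size reduced_delta e.
by rewrite -(peq_size h1) size_rcons.
Qed.

(** Both sides are equal to [i :: rcons (co_letter i) (rev_ord i)]. *)
Lemma delta_letter i :
  peq (i :: twist_word) (rcons twist_word (rev_ord i)).
Proof.
have [h1 h2] := peq_co_letter i; apply: peq_trans (peq_cons i (peq_sym h2)) _.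
by rewrite -rcons_cons -!cats1; apply: peq_catr.
Qed.

End ReducedWords.

(** * Positive words embed in the braid group *)

Section Embedding.

Variable n : nat.
Implicit Types (i j : 'I_n.-1) (k l : nat) (x y a b c : seq 'I_n.-1) (w : word n).

(** Powers of the square of Delta, which is central. Inverting a central element
instead of Delta itself makes denominators commute with everything. *)
Definition delta2 (k : nat) : seq 'I_n.-1 :=
  flatten (nseq k (twist_word n ++ twist_word n)).

Lemma delta2D k l : delta2 (k + l) = delta2 k ++ delta2 l.
Proof. by rewrite /delta2 nseqD flatten_cat. Qed.

Lemma delta2_central k x : peq (x ++ delta2 k) (delta2 k ++ x).
Proof.
suff letter i : peq (i :: delta2 k) (rcons (delta2 k) i).
  elim: x => [|i x IH] /=; first by rewrite cats0.
  by rewrite -cat_rcons IH -letter.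
elim: k => [|k IH] //; rewrite (delta2D 1) {1 3}/delta2 /= cats0 -!catA.
rewrite -cat_cons delta_letter cat_rcons.
by rewrite -cat_cons delta_letter cat_rcons rev_ordK IH !rcons_cat.
Qed.

Definition neg_count w : nat := count (fun l : 'I_n.-1 * bool => ~~ l.2) w.

(** The inverse of a letter [i] is [co_letter i] times Delta over the square of
Delta; [clear_neg] collects the numerators and [neg_count] the exponent of the
common denominator. *)
Definition clear_letter (l : 'I_n.-1 * bool) : seq 'I_n.-1 :=
  if l.2 then [:: l.1] else co_letter l.1 ++ twist_word n.

Definition clear_neg w : seq 'I_n.-1 := flatten (map clear_letter w).

Lemma clear_neg_cat w1 w2 : clear_neg (w1 ++ w2) = clear_neg w1 ++ clear_neg w2.
Proof. by rewrite /clear_neg map_cat flatten_cat. Qed.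

(** Equal braids are equal fractions. Transitivity is the place where left
cancellation in the monoid of positive words is used. *)
Lemma clear_neg_braid_eq w1 w2 : braid_eq w1 w2 ->
  peq (delta2 (neg_count w2) ++ clear_neg w1)
      (delta2 (neg_count w1) ++ clear_neg w2).
Proof.
elim=> {w1 w2} [w|w1 w2 _ /peq_sym|w1 w2 w3 _ h12 _ h23
  |u1 u2 v1 v2 _ hu _ hv|i b|i j h|i j h] //.
- apply: (@peq_cancel _ (delta2 (neg_count w2))).
  rewrite !catA -delta2D addnC delta2D -!catA h12 !catA -delta2D addnC.
  by rewrite delta2D -catA h23 !catA -!delta2D addnC.
- rewrite !clear_neg_cat /neg_count !count_cat -!/(neg_count _) !delta2D -!catA.
  rewrite (catA (delta2 (neg_count v2))) -(delta2_central _ (clear_neg u1)).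
  rewrite -!catA hv (catA (delta2 (neg_count u2))) hu -!catA.
  rewrite (catA (clear_neg u2)) (delta2_central _ (clear_neg u2)).
  by rewrite -!catA.
- case: b; rewrite /clear_neg /delta2 /= !cats0 ?cats1.
    by have [h _] := peq_co_letter i; rewrite -cat_cons h.
  have [_ h] := peq_co_letter i; have h' := delta_letter (rev_ord i).
  rewrite rev_ordK in h'.
  by rewrite rcons_cat -h' -cat_rcons h.
- by apply: (@peq_far n i j [::]); move: h; rewrite /far; lia.
- by apply: (@peq_near n i j [::]); move: h; rewrite /near; lia.
Qed.

Definition pbraid x : braid n := \prod_(i <- x) sigma i.

Lemma pbraid_nil : pbraid [::] = 1. Proof. exact: big_nil. Qed.

Lemma pbraid_cons i x : pbraid (i :: x) = sigma i * pbraid x.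
Proof. exact: big_cons. Qed.

Lemma pbraid_cat x y : pbraid (x ++ y) = pbraid x * pbraid y.
Proof. exact: big_cat. Qed.

Lemma pbraidE x : pbraid x = braid_of [seq (i, true) | i <- x].
Proof.
elim: x => [|i x IH] /=; first by rewrite pbraid_nil.
by rewrite pbraid_cons IH [LHS]braid_mulE.
Qed.

Lemma pbraid_peq x y : peq x y -> pbraid x = pbraid y.
Proof.
elim=> // {}x {}y z h _ <-; elim: h => [i j w h|i j w h|i w w' _ IH];
  rewrite !pbraid_cons ?IH // !mulgA.
  by rewrite sigma_far //; move: h; rewrite /far; lia.
by rewrite sigma_near //; move: h; rewrite /near; lia.
Qed.

(** Garside's embedding theorem: positive words have denominator 1, so the
equality of fractions is an equality of words. *)
Lemma pbraid_inj x y : pbraid x = pbraid y -> peq x y.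
Proof.
rewrite !pbraidE => /braid_ofP/clear_neg_braid_eq.
have neg z : neg_count [seq (i, true) | i <- z] = 0 by elim: z.
have clear z : clear_neg [seq (i, true) | i <- z] = z.
  by elim: z => //= i z IH; rewrite -[in RHS]IH.
by rewrite !neg !clear.
Qed.

End Embedding.

(** * Divisibility of positive braids and greatest common divisors *)

Section Divisibility.

Variable n : nat.
Implicit Types (i j : 'I_n.-1) (w : seq 'I_n.-1) (x y z a b : braid n).

Lemma positiveP x : positive x <-> exists w, x = pbraid w.
Proof.
split=> [|[w ->]].
  elim=> [|i|_ _ _ [w1 ->] _ [w2 ->]].
  - by exists [::]; rewrite pbraid_nil.
  - by exists [:: i]; rewrite pbraid_cons pbraid_nil mulg1.
  - by exists (w1 ++ w2); rewrite pbraid_cat.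
elim: w => [|i w IH]; rewrite ?pbraid_nil ?pbraid_cons; first exact: Positive1.
by apply: PositiveM => //; exact: PositiveSigma.
Qed.

Lemma positive_pbraid w : positive (pbraid w).
Proof. by apply/positiveP; exists w. Qed.

Lemma pbraid_eq1 w : pbraid w = 1 -> w = [::].
Proof. by rewrite -(pbraid_nil n) => /pbraid_inj/peq_size/size0nil. Qed.

Lemma positive_anti x : positive x -> positive x^-1 -> x = 1.
Proof.
move=> /positiveP[w ->] /positiveP[v e].
have : pbraid (w ++ v) = 1 by rewrite pbraid_cat -e mulgV.
by move/pbraid_eq1; case: w {e} => //; rewrite pbraid_nil.
Qed.

(** Divisibility in the submonoid, written in the group. For positive [x] it is
the relation of divisors among positive braids, and it is invariant under left
translation by any braid. *)
Definition ldvd x y : Prop := positive (x^-1 * y).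
Definition rdvd x y : Prop := positive (y * x^-1).

Lemma ldvd_refl x : ldvd x x.
Proof. by rewrite /ldvd mulVg; exact: Positive1. Qed.

Lemma ldvd_trans y x z : ldvd x y -> ldvd y z -> ldvd x z.
Proof.
by move=> h1 h2; rewrite /ldvd -[z](mulKVg y) mulgA; exact: PositiveM.
Qed.

Lemma ldvd_mull a x y : ldvd (a * x) (a * y) <-> ldvd x y.
Proof. by rewrite /ldvd invgM -mulgA mulKg. Qed.

Lemma ldvd_mulr x y : positive y -> ldvd x (x * y).
Proof. by rewrite /ldvd mulKg. Qed.

Lemma ldvd_anti x y : ldvd x y -> ldvd y x -> x = y.
Proof.
move=> h1 h2; have : x^-1 * y = 1.
  by apply: positive_anti => //; rewrite invgM invgK.
by move/(canRL (mulKVg x)); rewrite mulg1.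
Qed.

Lemma ldvd1 x : ldvd 1 x <-> positive x.
Proof. by rewrite /ldvd invg1 mul1g. Qed.

Lemma left_divisorE x y : left_divisor x y <-> positive x /\ ldvd x y.
Proof.
split=> [[px py [z pz ->]]|[px h]]; first by split=> //; exact: ldvd_mulr.
split=> //; first by rewrite -(mulKVg x y); exact: PositiveM.
by exists (x^-1 * y); rewrite ?mulKVg.
Qed.

Lemma right_divisorE x y : right_divisor x y <-> positive x /\ rdvd x y.
Proof.
split=> [[px py [z pz ->]]|[px h]]; first by rewrite /rdvd mulgK.
split=> //; first by rewrite -(mulgKV x y); exact: PositiveM.
by exists (y * x^-1); rewrite ?mulgKV.
Qed.

Lemma positive_sigma i : positive (sigma i).
Proof. exact: PositiveSigma. Qed.

Lemma sigma_neq1 i : sigma i <> 1.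
Proof.
move=> e; have : pbraid [:: i] = 1 by rewrite pbraid_cons pbraid_nil mulg1.
by move/pbraid_eq1.
Qed.

Lemma sigma_ndvd1 i : ~ ldvd (sigma i) 1.
Proof.
rewrite /ldvd mulg1 => h; apply: (@sigma_neq1 i).
by apply: positive_anti => //; exact: positive_sigma.
Qed.

Lemma positive_first x : positive x -> x <> 1 -> exists i, ldvd (sigma i) x.
Proof.
move=> /positiveP[[|i w] ->]; first by rewrite pbraid_nil.
move=> _; exists i; rewrite pbraid_cons; apply: ldvd_mulr.
exact: positive_pbraid.
Qed.

(** Garside's lemma carried to the group by the embedding theorem. *)
Lemma sigma_lcm i j : exists c d, [/\ positive c, positive d,
  sigma i * c = sigma j * d &
  forall x, ldvd (sigma i) x -> ldvd (sigma j) x -> ldvd (sigma i * c) x].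
Proof.
have word x : ldvd (sigma i) x -> ldvd (sigma j) x ->
    exists v w, [/\ x = sigma i * pbraid v, x = sigma j * pbraid w &
      diamond i j v w].
  move=> /positiveP[v ev] /positiveP[w ew]; exists v, w.
  have e1 : x = sigma i * pbraid v by rewrite -ev mulKVg.
  have e2 : x = sigma j * pbraid w by rewrite -ew mulKVg.
  split=> //; apply: garside_diamond; apply: pbraid_inj.
  by rewrite !pbraid_cons -e1.
have [<-|fij|nij] := letter_cases i j.
- exists 1, 1; split; try exact: Positive1; first by [].
  by move=> x h _; rewrite mulg1.
- exists (sigma j), (sigma i); split; try exact: positive_sigma.
    by apply: sigma_far; move: fij; rewrite /far; lia.
  move=> x hi hj; have [v [w [-> _ dvw]]] := word x hi hj.
  have [t [/pbraid_peq-> _]] := diamond_far fij dvw.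
  by rewrite ldvd_mull pbraid_cons; apply: ldvd_mulr; exact: positive_pbraid.
- exists (sigma j * sigma i), (sigma i * sigma j).
  split; try by apply: PositiveM; exact: positive_sigma.
    by rewrite !mulgA; apply: sigma_near; move: nij; rewrite /near; lia.
  move=> x hi hj; have [v [w [-> _ dvw]]] := word x hi hj.
  have [t [/pbraid_peq-> _]] := diamond_near nij dvw.
  rewrite ldvd_mull !pbraid_cons mulgA; apply: ldvd_mulr.
  exact: positive_pbraid.
Qed.

(** The common left divisors of [x] and [y] are reached from 1 by adding one
generator at a time. If two generators can be added to a common divisor, so can
their least common multiple; thus this process is locally confluent. It stops
since lengths are bounded, and, as in Newman's lemma, its end is unique. *)
Lemma gcdL_ex x y : positive x -> positive y -> exists g,
  [/\ ldvd g x, ldvd g y & forall e, ldvd 1 e -> ldvd e x -> ldvd e y -> ldvd e g].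
Proof.
move=> px py; pose common d := ldvd d x /\ ldvd d y.
have px1 : common 1 by split; rewrite ldvd1.
suff gen d : common d -> exists g, [/\ common g, ldvd d g &
    forall e, common e -> ldvd d e -> ldvd e g].
  have [g [[gx gy] _ h]] := gen 1 px1.
  by exists g; split=> // e pe ex ey; apply: h.
move=> hd; case: (hd) => /positiveP[w].
have [m] := ubnP (size w); elim: m d w hd => // m IH d w hd hm ew _.
(* Induction on the length [m] that [d] leaves in [x]. *)
have [[i hi]|no] := EM (exists i, common (d * sigma i)); last first.
  exists d; split=> // [|e [ex ey] de]; first exact: ldvd_refl.
  have [e1|/(positive_first de)[i hi]] := EM (d^-1 * e = 1).
    by rewrite -[e](mulKVg d) e1 mulg1; exact: ldvd_refl.
  have de' : ldvd (d * sigma i) e by rewrite -[e](mulKVg d) ldvd_mull.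
  by case: no; exists i; split; exact: ldvd_trans de' _.
have IHs k : common (d * sigma k) -> exists g, [/\ common g, ldvd (d * sigma k) g &
    forall e, common e -> ldvd (d * sigma k) e -> ldvd e g].
  move=> hk; case: (hk) => /positiveP[v ev] hky; apply: (IH _ v) => //.
  have /peq_size : peq w (k :: v).
    by apply: pbraid_inj; rewrite pbraid_cons -ew -ev invgM -mulgA mulKVg.
  by move: hm => /= + e; rewrite e /=; lia.
have [g [hg dg gmax]] := IHs i hi.
exists g; split=> // [|e he de].
  by apply: ldvd_trans dg; apply: ldvd_mulr; exact: positive_sigma.
have [e1|/(positive_first de)[j hj]] := EM (d^-1 * e = 1).
  rewrite -[e](mulKVg d) e1 mulg1; apply: ldvd_trans dg.
  by apply: ldvd_mulr; exact: positive_sigma.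
have de' : ldvd (d * sigma j) e by rewrite -[e](mulKVg d) ldvd_mull.
have hcj : common (d * sigma j).
  by case: he => ex ey; split; exact: ldvd_trans de' _.
have [c [c' [pc pc' ecc' lcm]]] := sigma_lcm i j.
have lcm_d t : ldvd (d * sigma i) t -> ldvd (d * sigma j) t ->
    ldvd (d * (sigma i * c)) t.
  by rewrite -[t](mulKVg d) !ldvd_mull; exact: lcm.
have hm' : common (d * (sigma i * c)).
  by case: hi hcj => hix hiy [hjx hjy]; split; apply: lcm_d.
(* The ends [g] and [g'] of the two branches both lie above the least common
   multiple, hence above the first step of the other branch: they coincide. *)
have [g' [hg' dg' gmax']] := IHs j hcj.
apply: ldvd_trans (gmax' e he de') _; apply: gmax => //.
apply: (@ldvd_trans (d * (sigma i * c))).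
  by rewrite mulgA; apply: ldvd_mulr.
by apply: gmax' => //; rewrite ecc' mulgA; apply: ldvd_mulr.
Qed.

End Divisibility.

(** * Simple braids and normal pairs *)

Section SimpleBraids.

Variable n : nat.
Implicit Types (i j : 'I_n.-1) (w : seq 'I_n.-1) (x y z a b s t u : braid n).

Lemma DeltaE : Delta = pbraid (twist_word n).
Proof.
suff gen k : Delta_rec n k = pbraid (delta_word n k) by exact: gen.
elim: k => [|k IH] /=; first by rewrite pbraid_nil.
by rewrite pbraid_cat IH /pbraid big_filter enumT.
Qed.

Lemma sigmaJ_Delta i : sigma i ^ Delta = sigma (rev_ord i).
Proof.
have /pbraid_peq := delta_letter i.
rewrite pbraid_cons -cats1 pbraid_cat pbraid_cons pbraid_nil mulg1 -DeltaE.
by rewrite conjgE => ->; rewrite mulKg.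
Qed.

Lemma positiveJ x : positive x -> positive (x ^ Delta).
Proof.
elim=> [|i|y z _ hy _ hz]; first by rewrite conj1g; exact: Positive1.
  by rewrite sigmaJ_Delta; exact: positive_sigma.
by rewrite conjMg; exact: PositiveM.
Qed.

Lemma positiveJV x : positive x -> positive (x ^ Delta^-1).
Proof.
elim=> [|i|y z _ hy _ hz]; first by rewrite conj1g; exact: Positive1.
  by rewrite -(rev_ordK i) -sigmaJ_Delta conjgK; exact: positive_sigma.
by rewrite conjMg; exact: PositiveM.
Qed.

Lemma positiveJE x : positive (x ^ Delta) <-> positive x.
Proof. by split=> [/positiveJV|/positiveJ//]; rewrite conjgK. Qed.

(** The two quotients of Delta by [x] are conjugate under Delta, which preserves
positivity. *)
Lemma ldvd_rdvd_Delta x : ldvd x Delta <-> rdvd x Delta.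
Proof.
rewrite /ldvd /rdvd -(positiveJE (Delta * _)) conjgE.
by rewrite mulgA mulKg.
Qed.

Lemma simpleE s : simple s <-> positive s /\ ldvd s Delta.
Proof. exact: left_divisorE. Qed.

Lemma simple_positive s : simple s -> positive s.
Proof. by case/simpleE. Qed.

Lemma simple_Delta : simple (Delta : braid n).
Proof.
apply/simpleE; split; last exact: ldvd_refl.
by rewrite DeltaE; exact: positive_pbraid.
Qed.

Lemma simple_ldvd s t : positive s -> ldvd s t -> simple t -> simple s.
Proof.
by move=> ps h /simpleE[_ ht]; apply/simpleE; split; last exact: ldvd_trans ht.
Qed.

Lemma simple_rdvd s t : positive s -> rdvd s t -> simple t -> simple s.
Proof.
move=> ps h /simpleE[_ /ldvd_rdvd_Delta ht]; apply/simpleE; split=> //.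
apply/ldvd_rdvd_Delta; rewrite /rdvd -[Delta](mulgKV t) -mulgA.
exact: PositiveM.
Qed.

Lemma simpleJ s : simple (s ^ Delta) <-> simple s.
Proof.
rewrite !simpleE positiveJE /ldvd -(positiveJE (s^-1 * _)) conjMg conjVg.
by rewrite (_ : Delta ^ Delta = Delta) // conjgE mulKg.
Qed.

(** Simple braids are the positive lifts of permutations. Any factor of Delta is a
right factor, so its words are suffixes of a reduced word; conversely a reduced
word extends to one of the longest permutation, which by Matsumoto's theorem
spells Delta. *)
Lemma simpleP s : simple s <-> exists2 w, reduced w & s = pbraid w.
Proof.
split=> [/simpleE[/positiveP[w ->] /ldvd_rdvd_Delta/positiveP[v ev]]|[w rw ->]].
  exists w => //; apply: (@reduced_catr _ v).
  rewrite (@reduced_peq _ _ (twist_word n)) ?reduced_delta //.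
  by apply: pbraid_inj; rewrite pbraid_cat -ev mulgKV DeltaE.
apply/simpleE; split; first exact: positive_pbraid.
have [c [rc ec]] := reduced_extend rw; apply/ldvd_rdvd_Delta.
have /pbraid_peq : peq (c ++ w) (twist_word n).
  by apply: reduced_peq_perm; rewrite ?reduced_delta // ec wperm_delta.
by rewrite pbraid_cat DeltaE => <-; rewrite /rdvd mulgK; exact: positive_pbraid.
Qed.

(** A letter put before a reduced word makes a new inversion, and then the longer
word is reduced, or undoes one, and then Matsumoto's theorem brings that letter
to the front of the word. *)
Lemma simple_mulsl i s : simple s -> ~ ldvd (sigma i) s -> simple (sigma i * s).
Proof.
move=> /simpleP[w rw ->] nd; apply/simpleP.
exists (i :: w); last by rewrite pbraid_cons.
rewrite /= rw andbT; apply/negPn/negP => di; apply: nd.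
have [c rc ec] := reduced_word_ex (adj i * wperm w).
have /pbraid_peq -> : peq w (i :: c).
  apply: reduced_peq_perm => //=; first by rewrite rc ec ascent_adj di.
  by rewrite wperm_cons ec adjK.
by rewrite pbraid_cons; apply: ldvd_mulr; exact: positive_pbraid.
Qed.

(** Deduced from [simple_mulsl] for the complement [c] of [s], that is
[s * c = Delta]: if the generator divides [c] on the left, then it can be moved
to [s]; otherwise its product with [c] divides Delta on the right, which says
that it divides [s] on the right. *)
Lemma simple_mulsr i s : simple s -> ~ rdvd (sigma i) s -> simple (s * sigma i).
Proof.
move=> ss nd; have [ps hs] := (simpleE s).1 ss.
have psi : positive (s * sigma i) by apply: PositiveM => //; exact: positive_sigma.
have sc : simple (s^-1 * Delta).
  apply: simple_rdvd simple_Delta => //.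
  by rewrite /rdvd invgM mulKVg invgK.
apply/simpleE; split=> //.
have [h|/(simple_mulsl sc)] := EM (ldvd (sigma i) (s^-1 * Delta)).
  by move: h; rewrite /ldvd invgM mulgA.
case/simpleE=> _ /ldvd_rdvd_Delta; rewrite /rdvd !invgM invgK mulgA mulKVg.
by move=> h; case: nd.
Qed.

(** A reduced word cannot contain a repeated letter, since the second occurrence
would undo the inversion made by the first. *)
Lemma simple_square_free i s : rdvd (sigma i) s -> ~ simple (s * sigma i).
Proof.
move=> /positiveP[v ev] /simpleP[w rw ew].
have : reduced (v ++ [:: i; i]).
  rewrite (@reduced_peq _ _ w) //; apply: pbraid_inj; rewrite -ew pbraid_cat -ev.
  by rewrite !pbraid_cons pbraid_nil mulg1 mulgA mulgKV.
by move/reduced_catr; rewrite /= wperm_cons ascent_adj; case: (ascent _ _).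
Qed.

Definition normal_pair a b : Prop := forall i, ldvd (sigma i) b -> rdvd (sigma i) a.

(** In a normal pair the first entry is the greatest simple left divisor of the
product: otherwise the greatest one would be a proper multiple of [a], hence a
multiple of [a * sigma i] with [sigma i] dividing [b] on the left, thus dividing
[a] on the right, and would contain a square. *)
Lemma normal_pair_max a b y : simple a -> positive b -> normal_pair a b ->
  simple y -> ldvd y (a * b) -> ldvd y a.
Proof.
move=> sa pb nab /simpleE[py yD] yab; have [pa aD] := (simpleE a).1 sa.
have [g [gab gD gmax]] : exists g, [/\ ldvd g (a * b), ldvd g Delta &
    forall e, ldvd 1 e -> ldvd e (a * b) -> ldvd e Delta -> ldvd e g].
  apply: gcdL_ex; first exact: PositiveM.
  exact: simple_positive simple_Delta.
have ag : ldvd a g by apply: gmax; rewrite ?ldvd1 //; exact: ldvd_mulr.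
have yg : ldvd y g by apply: gmax; rewrite ?ldvd1.
have [e|/(positive_first ag)[i hi]] := EM (a^-1 * g = 1).
  by rewrite (_ : a = g) // -[RHS](mulKVg a) e mulg1.
case: (@simple_square_free i a); first apply: nab.
  by apply: ldvd_trans hi _; rewrite -[b](mulKg a) ldvd_mull.
apply/simpleE; split; first by apply: PositiveM => //; exact: positive_sigma.
by apply: ldvd_trans gD; rewrite -[g](mulKVg a) ldvd_mull.
Qed.

Definition coprimeL a b : Prop :=
  forall i, ldvd (sigma i) a -> ~ ldvd (sigma i) b.

(** Since [a] and [b] are coprime on the left, [a * x] is the least common left
multiple of [x] and [y], and Delta is a common left multiple too. The proof needs only greatest
common left divisors. With [p * a = Delta], the element [p] is the greatest
common left divisor of [Delta] and [p * b], since [a] and [b] are coprime. As [x]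
and [y] are simple, the conjugate [Delta * x * Delta^-1] divides both [Delta] and
[p * b], hence divides [p]; this says that [a * x] divides [Delta]. *)
Lemma coprime_simple a b x y : positive a -> positive b -> coprimeL a b ->
  simple a -> simple x -> simple y -> a * x = b * y -> simple (a * x).
Proof.
move=> pa pb cop /simpleE[_ aD] /simpleE[px xD] /simpleE[py yD] e.
apply/simpleE; split; first exact: PositiveM.
move: xD yD; rewrite !ldvd_rdvd_Delta => xD yD.
pose p := Delta * a^-1; have pp : positive p by apply/ldvd_rdvd_Delta.
have [d [dD dpb dmax]] : exists d, [/\ ldvd d Delta, ldvd d (p * b) &
    forall e, ldvd 1 e -> ldvd e Delta -> ldvd e (p * b) -> ldvd e d].
  apply: gcdL_ex; first exact: simple_positive simple_Delta.
  exact: PositiveM.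
have epa : p * a = Delta by rewrite mulgKV.
have pd : ldvd p d.
  by apply: dmax; rewrite ?ldvd1 //; [rewrite -epa|]; exact: ldvd_mulr.
have edp : d = p.
  have [e1|/(positive_first pd)[i hi]] := EM (p^-1 * d = 1).
    by rewrite -[d](mulKVg p) e1 mulg1.
  case: (cop i); apply: ldvd_trans hi _.
    by rewrite -[a](mulKg p) epa ldvd_mull.
  by rewrite -[b](mulKg p) ldvd_mull.
suff : ldvd (x ^ Delta^-1) p.
  by rewrite /ldvd /rdvd -conjVg conjgE invgK invgM /p !mulgA mulgKV.
rewrite -edp; apply: dmax; first by rewrite ldvd1; exact: positiveJV.
  by rewrite /ldvd -conjVg conjgE invgK !mulgA mulgKV.
rewrite /ldvd -conjVg conjgE invgK /p !mulgA mulgKV -(mulgA Delta x^-1) -invgM e.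
by rewrite invgM mulgA mulgKV.
Qed.

(** The argument given at the top of the file, with [t1] and [t2] for the new
entries and [s1^-1 * u0], [s2^-1 * u1] for the two cofactors. *)
Lemma normal_pair_domino s1 s2 u0 u1 u2 t1 t2 :
  simple s1 -> simple s2 -> simple u0 -> simple u1 -> simple u2 ->
  simple t1 -> simple t2 ->
  s1 * u1 = u0 * t1 -> s2 * u2 = u1 * t2 ->
  normal_pair s1 s2 -> normal_pair u0 t1 -> normal_pair u1 t2 ->
  normal_pair t1 t2.
Proof.
move=> ss1 ss2 su0 su1 su2 st1 st2 e1 e2 ns n1 n2 i it2.
have [//|nit1] := EM (rdvd (sigma i) t1).
have v0 : ldvd s1 u0.
  apply: normal_pair_max n1 ss1 _ => //; first exact: simple_positive.
  by rewrite -e1; apply: ldvd_mulr; exact: simple_positive.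
have v1 : ldvd s2 u1.
  apply: normal_pair_max n2 ss2 _ => //; first exact: simple_positive.
  by rewrite -e2; apply: ldvd_mulr; exact: simple_positive.
have sv0 : simple (s1^-1 * u0).
  apply: simple_rdvd su0 => //.
  by rewrite /rdvd invgM invgK mulKVg; exact: simple_positive.
have ev : s1^-1 * u0 * t1 = u1 by rewrite -mulgA -e1 mulKg.
case: (@simple_square_free i u1); first exact: n2.
rewrite -ev -mulgA; apply: (@coprime_simple _ s2 _ (s2^-1 * u1 * sigma i)) => //.
- exact: simple_positive.
- move=> j hj hs2; apply: (@simple_square_free j s1); first exact: ns.
  apply: simple_ldvd su0.
    by apply: PositiveM; [exact: simple_positive | exact: positive_sigma].
  by rewrite -[u0](mulKVg s1) ldvd_mull.
- exact: simple_mulsr.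
- apply: simple_ldvd su2; first by apply: PositiveM => //; exact: positive_sigma.
  by rewrite -[u2](mulKg s2) e2 -mulgA !ldvd_mull.
- by rewrite mulgA ev -mulgA mulKVg.
Qed.

Lemma normal_seqP (w0 : seq (braid n)) : normal_seq w0 <->
  (forall s, s \in w0 -> simple s) /\
  (forall k, (k.+1 < size w0)%N -> normal_pair (nth 1 w0 k) (nth 1 w0 k.+1)).
Proof.
split=> -[h1 h2]; split=> // k hk i.
  move=> h; have := conj (positive_sigma i) h.
  by move=> /left_divisorE/(h2 k hk)/right_divisorE[].
case/left_divisorE=> p h; apply/right_divisorE; split=> //.
exact: h2 hk _ h.
Qed.

Lemma normal_seq2 a b : normal_seq [:: a; b] -> normal_pair a b.
Proof. by move=> /normal_seqP[_ /(_ 0%N)]; exact. Qed.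

(** Case (i) without its bookkeeping; case (ii) is reduced to it as well. *)
Lemma push_normal (s t : seq (braid n)) (u_ : nat -> braid n) :
  normal_seq s -> size t = size s -> simple (u_ (size s)) ->
  (forall k, (k < size s)%N -> [/\ simple (u_ k), simple (nth 1 t k),
     nth 1 s k * u_ k.+1 = u_ k * nth 1 t k & normal_pair (u_ k) (nth 1 t k)]) ->
  normal_seq (u_ 0%N :: t) /\
  \prod_(x <- s) x * u_ (size s) = u_ 0%N * \prod_(x <- t) x.
Proof.
move=> /normal_seqP[ss ns] est su h; split.
  apply/normal_seqP; split=> [x|[|k]] /=.
  - rewrite inE => /predU1P[->|/(nthP 1)[k]]; last first.
      by rewrite est => /h[_ + _ _] => /[swap] ->.
    by case: (size s) su h => [//|m] _ /(_ 0%N)[].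
  - by rewrite ltnS est => /h[].
  - rewrite ltnS est => hk; have [s1 s2 s3 s4] := h _ hk.
    have [t1 t2 t3 t4] := h _ (ltnW hk).
    apply: (normal_pair_domino _ _ t1 s1 _ t2 s2 t3 s3 _ t4 s4).
    + exact/ss/mem_nth/ltnW.
    + exact/ss/mem_nth.
    (* The last of the [u_] is the given one; it is outside the range of [h]. *)
    + have [-> //|ne] := eqVneq k.+2 (size s).
      by have [|//] := h k.+2; rewrite ltn_neqAle ne.
    + exact: ns.
clear ss ns su; elim: s t u_ est h => [|a s IH] [|b t] u_ //= est h.
  by rewrite !big_nil mul1g mulg1.
rewrite !big_cons -mulgA (IH t (fun k => u_ k.+1)) //; first last.
- by move=> k hk; exact: (h k.+1).
- by case: est.
by have [_ _ /= e _] := h 0%N isT; rewrite !mulgA e.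
Qed.

Lemma trim1 (w : seq (braid n)) : exists (w' : seq (braid n)) (k : nat),
  w = w' ++ nseq k 1 /\ (w' <> [::] -> last 1 w' <> 1).
Proof.
elim/last_ind: w => [|w x [w' [k [e h]]]]; first by exists [::], 0%N.
have [->|nx] := EM (x = 1).
  by exists w', k.+1; split=> //; rewrite e -cats1 -catA -(addn1 k) nseqD.
by exists (rcons w x), 0%N; rewrite cats0 last_rcons.
Qed.

Lemma greedy_nf_trim z m (w : seq (braid n)) :
  z = expgz Delta m * \prod_(x <- w) x ->
  normal_seq w -> (w <> [::] -> head 1 w <> Delta) -> greedy_nf_upto1 z m w.
Proof.
move=> ez /normal_seqP[ss ns] hd; have [w' [k [e hl]]] := trim1 w.
exists w', k; split=> //; split.
- rewrite ez e big_cat /= [X in _ * (_ * X)]big1_seq ?mulg1 //.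
  by move=> x /andP[_ /nseqP[]].
- apply/normal_seqP; split=> [x hx|j hj]; first by apply: ss; rewrite e mem_cat hx.
  have := ns j; rewrite e size_cat !nth_cat hj (ltnW hj); apply.
  by rewrite ltn_addr.
- move=> nw; split; last exact: hl.
  by move: hd; rewrite e; case: (w') nw => //= a l _; apply.
Qed.

Lemma expgzS m : expgz (Delta : braid n) (m + 1)%R = expgz Delta m * Delta.
Proof.
case: m => [k|[|k]] /=; first by rewrite addn1 expgSr.
  by rewrite mulVg.
by rewrite subn1 [in RHS]expgS invgM mulgKV.
Qed.

End SimpleBraids.

(** * Greedy normal forms *)

Section NormalForms.

Variable n : nat.
Implicit Types (i j : 'I_n.-1) (x y z a b u : braid n) (s t w : seq (braid n)).

Lemma expgzB (m : int) :
  expgz (Delta : braid n) (m - 1)%R = expgz Delta m * Delta^-1.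
Proof. by rewrite -{2}(GRing.subrK 1%R m) expgzS mulgK. Qed.

Lemma ldvdJ a b : ldvd (a ^ Delta) (b ^ Delta) <-> ldvd a b.
Proof. by rewrite /ldvd -conjVg -conjMg positiveJE. Qed.

Lemma normal_pairJ a b : normal_pair (a ^ Delta) (b ^ Delta) -> normal_pair a b.
Proof.
move=> h i hi; have := h (rev_ord i).
rewrite -sigmaJ_Delta /ldvd /rdvd -!conjVg -!conjMg !positiveJE; exact.
Qed.

Lemma normal_seqJ w : normal_seq [seq x ^ Delta | x <- w] -> normal_seq w.
Proof.
move=> /normal_seqP[ss ns]; apply/normal_seqP; split=> [x xw|k hk].
  by apply/simpleJ/ss/map_f.
apply: normal_pairJ; have := ns k; rewrite size_map.
by rewrite !(nth_map (1 : braid n)) ?(ltnW hk) //; apply.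
Qed.

Lemma prodJ w a : \prod_(x <- [seq x ^ a | x <- w]) x = (\prod_(x <- w) x) ^ a.
Proof.
elim: w => [|x w IH] /=; first by rewrite !big_nil conj1g.
by rewrite !big_cons IH conjMg.
Qed.

Lemma normal_seq_behead a w : normal_seq (a :: w) -> normal_seq w.
Proof.
move=> /normal_seqP[ss ns]; apply/normal_seqP; split=> [x xw|k hk].
  by apply: ss; rewrite inE xw orbT.
exact: (ns k.+1).
Qed.

(** This keeps the first entry of a normal form different from Delta when a Delta
is extracted in front of it. *)
Lemma Delta_factor a u : simple a -> simple u -> a * u = Delta * Delta ->
  a = Delta.
Proof.
move=> /simpleE[_ ha] /simpleE[_ /ldvd_rdvd_Delta hu] e; apply: ldvd_anti ha _.
have -> : a = Delta * (Delta * u^-1) by rewrite mulgA -e mulgK.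
exact: ldvd_mulr.
Qed.

Lemma pushed_head s t (v_ : nat -> braid n) : size t = size s ->
  (s <> [::] -> head 1 s <> Delta) -> normal_seq s ->
  ((0 < size s)%N -> simple (v_ 1%N) /\
     nth 1 s 0%N * v_ 1%N = v_ 0%N * nth 1 t 0%N) ->
  v_ 0%N = Delta -> t <> [::] -> head 1 t <> Delta.
Proof.
case: s t => [|a s] [|b t] //= _ hd /normal_seqP[ss _] h e0 _ eb.
have [su e] := h isT; apply: hd => //; apply: Delta_factor su _.
  by apply: ss; rewrite mem_head.
by rewrite e e0 eb.
Qed.

End NormalForms.

(* The entries s_1, ..., s_p and s'_1, ..., s'_p are nth 1 s i and nth 1 s' i for *)
(* i = 0, ..., p - 1, whereas u_0, ..., u_p keep their indices.                   *)
Theorem proposition2p15 (n : nat) (hn : (2 <= n)%N) (z : braid n) (m : int)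
    (s : seq (braid n)) (hz : greedy_nf z m s) (u : braid n) (hu : simple u) :
  (forall (u_ : nat -> braid n) (s' : seq (braid n)),
     size s' = size s ->
     u_ (size s) = u ->
     (forall i : nat, (i < size s)%N ->
        [/\ simple (u_ i), simple (nth 1 s' i),
            nth 1 s i * u_ i.+1 = u_ i * nth 1 s' i &
            normal_seq [:: u_ i; nth 1 s' i]]) ->
     (u_ 0%N = Delta -> greedy_nf_upto1 (z * u) (m + 1)%R s') /\
     (u_ 0%N <> Delta -> greedy_nf_upto1 (z * u) m (u_ 0%N :: s'))) /\
  (forall (u_ : nat -> braid n) (s' : seq (braid n)),
     size s' = size s ->
     u_ (size s) = u ->
     (forall i : nat, (i < size s)%N ->
        [/\ simple (u_ i), simple (nth 1 s' i),
            nth 1 s' i * u_ i.+1 = u_ i * nth 1 s i &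
            is_gcdL (nth 1 s' i) (u_ i) 1]) ->
     (u_ 0%N = 1 -> greedy_nf_upto1 (z * u^-1) m s') /\
     (u_ 0%N <> 1 ->
        greedy_nf_upto1 (z * u^-1) (m - 1)%R (lcompl (u_ 0%N) :: s'))).
Proof.
case: hz => ez nseq_s hds; have hd_s h := (hds h).1.
split=> u_ s' es eu h.
  have [|k hk|nus eus] := push_normal nseq_s es (u_ := u_).
  - by rewrite eu.
  - by have [h1 h2 h3 /normal_seq2 h4] := h k hk.
  have ezu : z * u = expgz Delta m * u_ 0%N * \prod_(x <- s') x.
    by rewrite ez -eu -!mulgA eus.
  split=> e0; apply: greedy_nf_trim => //.
  - by rewrite expgzS ezu e0.
  - exact: normal_seq_behead nus.
  - apply: pushed_head es hd_s nseq_s _ e0 => hs; have [_ _ h3 _] := h _ hs.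
    split=> //; have [h1|h1] := ltnP 1 (size s); first by case: (h _ h1).
    by rewrite (_ : 1%N = size s) ?eu //; lia.
  - by rewrite big_cons mulgA.
(* Case (ii): pass to the complements, which turns the equations of (ii) into
   those of (i) with each new entry conjugated by Delta. *)
pose v_ k := (u_ k)^-1 * Delta; pose t := [seq x ^ Delta | x <- s'].
have et : size t = size s by rewrite size_map.
have sv k : simple (u_ k) -> simple (v_ k).
  move=> su; have /simpleE[_ hD] := su.
  apply: simple_rdvd (simple_Delta n) => //.
  by rewrite /rdvd invgM invgK mulKVg; exact: simple_positive.
have su k : (k <= size s)%N -> simple (u_ k).
  by rewrite leq_eqVlt => /predU1P[->|/h[]//]; rewrite eu.
have hv k : (k < size s)%N -> [/\ simple (v_ k), simple (nth 1 t k),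
    nth 1 s k * v_ k.+1 = v_ k * nth 1 t k & normal_pair (v_ k) (nth 1 t k)].
  move=> hk; have [h1 h2 h3 [_ _ hg]] := h k hk.
  rewrite (nth_map 1) ?es //; split.
  - exact/sv/su/ltnW.
  - exact/simpleJ.
  - rewrite /v_ conjgE !mulgA mulgK; congr (_ * _).
    by apply: (mulIg (u_ k.+1)); rewrite mulgKV -mulgA h3 mulKg.
  (* If the generator can be added to [v_ k], then it divides the conjugate of
     [u_ k]; as it also divides that of the new entry, the two are not coprime. *)
  - move=> i hi; have [//|nd] := EM (rdvd (sigma i) (v_ k)).
    have /simpleE[_ hD] := simple_mulsr (sv _ h1) nd.
    have : left_divisor (sigma (rev_ord i)) 1.
      apply: hg; apply/left_divisorE; split; try exact: positive_sigma.
        by apply/ldvdJ; rewrite sigmaJ_Delta rev_ordK.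
      apply/ldvdJ; rewrite sigmaJ_Delta rev_ordK.
      by move: hD; rewrite /ldvd /v_ conjgE !invgM !invgK !mulgA.
    by move/left_divisorE=> [_ /sigma_ndvd1].
have [|nv ev] := push_normal nseq_s et (u_ := v_) _ hv; first exact/sv/su.
have ezu : z * u^-1 = expgz Delta m * (u_ 0%N)^-1 * \prod_(x <- s') x.
  rewrite ez -eu -[u_ (size s)]invgK.
  have := ev; rewrite prodJ /v_ conjgE !mulgA mulgK => /mulIg e.
  by rewrite invgK -mulgA e mulgA.
split=> e0; apply: greedy_nf_trim.
- by rewrite ezu e0 invg1 mulg1.
- exact/normal_seqJ/(normal_seq_behead nv).
- have : t <> [::] -> head 1 t <> Delta.
    apply: (@pushed_head _ s t v_) => // [hs|]; last by rewrite /v_ e0 invg1 mul1g.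
    by have [_ _ h3 _] := hv _ hs; split=> //; apply/sv/su.
  rewrite /t; case: (s') => //= x l hx _ ex; apply: hx => //.
  by rewrite ex conjgE mulKg.
- by rewrite big_cons expgzB ezu /lcompl !mulgA mulgKV.
- apply: normal_seqJ => /=; rewrite (_ : _ ^ _ = v_ 0%N) //.
  by rewrite /lcompl conjgE -!mulgA mulKg.
- by move=> _ /=; rewrite /lcompl => e; apply: e0; apply: invg_inj;
    rewrite invg1; apply: (mulgI Delta); rewrite mulg1.
Qed.
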